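(* Let $n\ge 2$, $t,u\in\mathbb{C}^\times$ and $1\le i\le n$. The odd Dunkl operator $$\eta_i=t\delta_i+u\sum_{k\neq i}(x_i^2-x_k^2)^{-1}\big[(x_i-x_k)s_{i,k}-x_i\tau_i+x_k\tau_k\big]$$ on the skew polynomial ring $P^-$ satisfies $$\eta_i=t\delta_i+u\sum_{k\ne i}\partial_{i,k}\,s_{i,k},$$ where the sums are over all $k\in\{1,\dots,n\}$ with $k\neq i$, and $\partial_{i,k}$ are the (extended) odd divided difference operators.
   Context: $P^-=\mathbb{C}\langle x_1,\dots,x_n\rangle/\langle x_ix_j+x_jx_i : i\ne j\rangle$ is the skew polynomial ring, graded with $\deg x_i=1$; $|f|$ denotes the degree of a homogeneous $f$. Operators are $\mathbb{C}$-linear; formulas involving $|f|$ are for homogeneous $f$ and are extended linearly. An element of the ring inside an operator expression denotes left multiplication by it. For $i\neq k$, $s_{i,k}$ is the algebra automorphism of $P^-$ exchanging $x_i$ and $x_k$ and fixing the other variables. $\tau_i$ is the algebra automorphism of $P^-$ with $\tau_i(x_i)=-x_i$ and $\tau_i(x_j)=x_j$ for $j\ne i$. The operator $\delta_i$ is $\delta_i=(2x_i)^{-1}(1-\tau_i)$. The odd divided difference operator for indices $i\neq k$ is $$\partial_{i,k}(f)=(x_k^2-x_i^2)^{-1}\big[(x_k-x_i)f-(-1)^{|f|}s_{i,k}(f)(x_k-x_i)\big].$$ The elements $x_j^2$ are central, and the inverses are taken in the localization of $P^-$ at the elements $x_j$ and $x_i^2-x_k^2$; $\delta_i$, $\partial_{i,k}$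 and $\eta_i$ map $P^-$ to $P^-$. *)

(* Defs.v *)
From HB Require Import structures.
From mathcomp Require Import all_boot all_order all_algebra perm.
From mathcomp Require Import finmap.
From mathcomp Require Import boolp classical_sets reals.
From mathcomp Require Import complex.
From mathcomp.multinomials Require Import monalg.

Set Implicit Arguments.
Unset Strict Implicit.
Unset Printing Implicit Defensive.

Import GRing.Theory.
Local Open Scope fset_scope.
Local Open Scope ring_scope.

Section FreeAlgebra.
Variables (K : fieldType) (I : choiceType).

(* K<I>: finitely supported K-valued functions on words in the alphabet I. *)
Definition free_alg := {malg K[{fmonom I}]}.
HB.instance Definition _ := GRing.Lalgebra.on free_alg.

Lemma free_scaleAr (c : K) (F G : free_alg) : c *: (F * G) = F * (c *: G).
Proof.
apply/malgP => k; rewrite mcoeffZ.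
rewrite (mcoeffMlw _ (fsubset_refl _) (fsubset_refl _)).
rewrite (mcoeffMlw _ (fsubset_refl _) (msuppZ_le _ _)) mulr_sumr.
apply: eq_bigr => w _; rewrite mulr_sumr; apply: eq_bigr => v _.
by rewrite mcoeffZ mulrnAr !mulrA (mulrC c).
Qed.
HB.instance Definition _ :=
  GRing.Lalgebra_isAlgebra.Build K free_alg free_scaleAr.

Definition fgen (i : I) : free_alg := << fmu i >>.

Definition two_sided_ideal (J : set free_alg) : Prop :=
  [/\ J 0, (forall F G, J F -> J G -> J (F + G)),
      (forall F G, J G -> J (F * G)) & (forall F G, J F -> J (F * G))].

Definition ideal_gen (rel : set free_alg) : set free_alg :=
  [set F | forall J, two_sided_ideal J -> (rel `<=` J)%classic -> J F].

Definition ideal_pred (rel : set free_alg) : free_alg -> bool :=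
  fun F => `[< ideal_gen rel F >].

Lemma ideal_genP rel : two_sided_ideal (ideal_gen rel).
Proof.
split=> [J [] //|F G hF hG J hJ hr|F G hG J hJ hr|F G hF J hJ hr];
  case: (hJ) => J0 JD Jl Jr.
- by apply: JD; [apply: hF|apply: hG].
- by apply: Jl; apply: hG.
- by apply: Jr; apply: hF.
Qed.

Lemma ideal_pred_zmod rel : zmod_closed (ideal_pred rel).
Proof.
have [h0 hD hl _] := ideal_genP rel.
split; first exact/asboolP.
move=> F G /asboolP hF /asboolP hG; apply/asboolP.
by apply: hD => //; rewrite -mulN1r; apply: hl.
Qed.
HB.instance Definition _ rel :=
  GRing.isZmodClosed.Build free_alg (ideal_pred rel) (ideal_pred_zmod rel).
Definition ideal_closed rel : zmodClosed free_alg :=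
  GRing.ZmodClosed.clone free_alg (ideal_pred rel) _.

(* The algebra K<I> / (rel).  As rel is arbitrary the quotient may be zero,
   hence the pzRingType structure below. *)
Definition pres_alg (rel : set free_alg) := Quotient.quot (ideal_closed rel).
HB.instance Definition _ rel := GRing.Zmodule.on (pres_alg rel).

Definition pres_pi rel (F : free_alg) : pres_alg rel :=
  (\pi_(Quotient.quot (ideal_closed rel)) F)%qT.

Definition pres_repr rel (f : pres_alg rel) : free_alg :=
  repr (f : Quotient.quot (ideal_closed rel)).

Definition pgen rel (i : I) : pres_alg rel := pres_pi rel (fgen i).

End FreeAlgebra.

Section PresentedStructure.
Variables (K : fieldType) (I : choiceType) (rel : set (free_alg K I)).
Local Notation A := (pres_alg rel).
Local Notation pi := (@pres_pi K I rel).
Local Notation rep := (@pres_repr K I rel).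

Lemma pres_reprK (f : A) : pi (rep f) = f.
Proof. exact: reprK. Qed.

Lemma pres_piP F G : pi F = pi G <-> ideal_gen rel (F - G).
Proof.
have h := @Quotient.idealrBE (free_alg K I) (ideal_closed rel) F G.
split=> [/eqP e|/asboolP e].
  by apply/asboolP; move: e; rewrite /pres_pi -h.
by apply/eqP; rewrite /pres_pi -h.
Qed.

Lemma pres_piB : {morph pi : F G / F - G}.
Proof.
by move=> F G; rewrite /pres_pi /= raddfB.
Qed.
HB.instance Definition _ :=
  GRing.isZmodMorphism.Build (free_alg K I) A pi pres_piB.

Lemma pres_piD : {morph pi : F G / F + G}.
Proof. exact: raddfD. Qed.

Lemma ideal_gen_repr F : ideal_gen rel (rep (pi F) - F).
Proof. by apply/pres_piP; rewrite pres_reprK. Qed.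

Definition pres_one : A := pi 1.
(* Locked so that conversion does not compute in the free algebra. *)
Fact pres_key : unit. Proof. by []. Qed.
Definition pres_mul : A -> A -> A :=
  locked_with pres_key (fun f g => pi (rep f * rep g)).
Definition pres_scale : K -> A -> A :=
  locked_with pres_key (fun c f => pi (c *: rep f)).

Lemma pres_piM F G : pi (F * G) = pres_mul (pi F) (pi G).
Proof.
have [_ hD hl hr] := ideal_genP rel.
rewrite /pres_mul unlock; apply/esym/pres_piP.
set F' := rep (pi F); set G' := rep (pi G).
have -> : F' * G' - F * G = (F' - F) * G' + F * (G' - G).
  by rewrite mulrBl mulrBr addrA subrK.
exact: (hD _ _ (hr _ _ (ideal_gen_repr F)) (hl _ _ (ideal_gen_repr G))).
Qed.

Lemma pres_piZ c F : pi (c *: F) = pres_scale c (pi F).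
Proof.
have [_ _ hl _] := ideal_genP rel.
rewrite /pres_scale unlock; apply/esym/pres_piP; rewrite -scalerBr -mulr_algl.
exact: (hl _ _ (ideal_gen_repr F)).
Qed.

Lemma pres_ind (P : A -> Prop) : (forall F, P (pi F)) -> forall f, P f.
Proof. by move=> h f; rewrite -(pres_reprK f). Qed.

Lemma pres_mulA : associative pres_mul.
Proof.
by elim/pres_ind=> F; elim/pres_ind=> G; elim/pres_ind=> H; rewrite -!pres_piM mulrA.
Qed.
Lemma pres_mul1r : left_id pres_one pres_mul.
Proof. by elim/pres_ind=> F; rewrite -pres_piM mul1r. Qed.
Lemma pres_mulr1 : right_id pres_one pres_mul.
Proof. by elim/pres_ind=> F; rewrite -pres_piM mulr1. Qed.
Lemma pres_mulDl : left_distributive pres_mul +%R.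
Proof.
elim/pres_ind=> F; elim/pres_ind=> G; elim/pres_ind=> H.
by rewrite -pres_piD -!pres_piM -pres_piD mulrDl.
Qed.
Lemma pres_mulDr : right_distributive pres_mul +%R.
Proof.
elim/pres_ind=> F; elim/pres_ind=> G; elim/pres_ind=> H.
by rewrite -pres_piD -!pres_piM -pres_piD mulrDr.
Qed.
HB.instance Definition _ := GRing.Zmodule_isPzRing.Build A
  pres_mulA pres_mul1r pres_mulr1 pres_mulDl pres_mulDr.

Lemma pres_scaleA a b f : pres_scale a (pres_scale b f) = pres_scale (a * b) f.
Proof. by elim/pres_ind: f => F; rewrite -!pres_piZ scalerA. Qed.
Lemma pres_scale1 : left_id 1 pres_scale.
Proof. by elim/pres_ind=> F; rewrite -pres_piZ scale1r. Qed.
Lemma pres_scaleDr : right_distributive pres_scale +%R.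
Proof.
move=> c; elim/pres_ind=> F; elim/pres_ind=> G.
by rewrite -pres_piD -!pres_piZ -pres_piD scalerDr.
Qed.
Lemma pres_scaleDl f : {morph pres_scale^~ f : a b / a + b}.
Proof. by move=> a b; elim/pres_ind: f => F; rewrite -!pres_piZ -pres_piD scalerDl. Qed.
HB.instance Definition _ := GRing.Zmodule_isLmodule.Build K A
  pres_scaleA pres_scale1 pres_scaleDr pres_scaleDl.

Lemma pres_pi_monoid : monoid_morphism pi.
Proof. by split; [reflexivity|exact: pres_piM]. Qed.
HB.instance Definition _ :=
  GRing.isMonoidMorphism.Build (free_alg K I) A pi pres_pi_monoid.
HB.instance Definition _ :=
  GRing.isScalable.Build K (free_alg K I) A *:%R pi pres_piZ.

Lemma pres_rmulE F G : pi F * pi G = pi (F * G).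
Proof. by rewrite rmorphM. Qed.
Lemma pres_scaleE c F : c *: pi F = pi (c *: F).
Proof. by rewrite linearZ. Qed.

Lemma pres_scaleAl c (f g : A) : c *: (f * g) = c *: f * g.
Proof.
elim/pres_ind: f => F; elim/pres_ind: g => G.
by rewrite pres_rmulE pres_scaleE (pres_scaleE c F) pres_rmulE scalerAl.
Qed.

Lemma pres_scaleAr c (f g : A) : c *: (f * g) = f * (c *: g).
Proof.
elim/pres_ind: f => F; elim/pres_ind: g => G.
by rewrite pres_rmulE pres_scaleE (pres_scaleE c G) pres_rmulE scalerAr.
Qed.

End PresentedStructure.

Section Evaluation.
Variables (K : fieldType) (I : choiceType) (A : algType K) (h : I -> A).

(* The algebra morphism K<I> -> A with i |-> h i. *)
Definition word_eval (w : {fmonom I}) : A := \prod_(i <- (w : seq I)) h i.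
Definition feval : free_alg K I -> A := mmap (GRing.in_alg A) word_eval.

Lemma word_eval_mmorphism : mmorphism word_eval.
Proof.
split; last by rewrite /word_eval fm1 big_nil.
by move=> v w; rewrite /word_eval fmM big_cat.
Qed.
HB.instance Definition _ :=
  isMultiplicative.Build {fmonom I} A word_eval word_eval_mmorphism.

Lemma feval_zmod : zmod_morphism feval.
Proof. by move=> F G; rewrite /feval raddfB. Qed.
HB.instance Definition _ :=
  GRing.isZmodMorphism.Build (free_alg K I) A feval feval_zmod.

Lemma feval_monoid : monoid_morphism feval.
Proof.
have [hM h1] := @commr_mmap_is_multiplicative {fmonom I} K A (GRing.in_alg A)
  word_eval (fun F m m' => comm_alg _ _).
by [].
Qed.
HB.instance Definition _ :=
  GRing.isMonoidMorphism.Build (free_alg K I) A feval feval_monoid.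

Lemma feval_scalable : scalable feval.
Proof. by move=> c F; rewrite /feval mmapZ /= mulr_algl. Qed.
HB.instance Definition _ :=
  GRing.isScalable.Build K (free_alg K I) A *:%R feval feval_scalable.

Lemma fevalD F G : feval (F + G) = feval F + feval G.
Proof. exact: raddfD. Qed.
Lemma fevalM F G : feval (F * G) = feval F * feval G.
Proof. exact: rmorphM. Qed.

Lemma feval_gen i : feval (fgen K i) = h i.
Proof.
by rewrite /feval /fgen mmapU /= scale1r mul1r /word_eval fmU big_seq1.
Qed.

Lemma feval_anticomm i j :
  feval (fgen K i * fgen K j + fgen K j * fgen K i) = h i * h j + h j * h i.
Proof. by rewrite fevalD; congr (_ + _); rewrite fevalM; congr (_ * _); rewrite feval_gen. Qed.

End Evaluation.

Section Substitution.
Variables (K : fieldType) (I J : choiceType).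
Variables (relI : set (free_alg K I)) (relJ : set (free_alg K J)).
Variable h : I -> free_alg K J.

(* The map K<I>/(relI) -> K<J>/(relJ) induced by i |-> h i.  It is defined on a
   representative, so it is an algebra morphism under hypothesis relh below. *)
Definition pres_subst (f : pres_alg relI) : pres_alg relJ :=
  pres_pi relJ (feval h (pres_repr f)).

Hypothesis relh : forall r, relI r -> ideal_gen relJ (feval h r).

Lemma feval_ideal F : ideal_gen relI F -> ideal_gen relJ (feval h F).
Proof.
have [h0 hD hl hr] := ideal_genP relJ.
move=> hF; refine (hF (fun G => ideal_gen relJ (feval h G)) _ relh).
split=> [|F1 F2 h1 h2|F1 F2 h2|F1 F2 h1].
- by rewrite rmorph0; exact: h0.
- by rewrite rmorphD; exact: (hD _ _ h1 h2).
- by rewrite rmorphM; exact: (hl _ _ h2).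
- by rewrite rmorphM; exact: (hr _ _ h1).
Qed.

Lemma pres_subst_pi F : pres_subst (pres_pi relI F) = pres_pi relJ (feval h F).
Proof.
apply/pres_piP; rewrite -rmorphB.
exact: (feval_ideal (ideal_gen_repr F)).
Qed.

Lemma pres_subst_gen i : pres_subst (pgen relI i) = pres_pi relJ (h i).
Proof. by rewrite pres_subst_pi feval_gen. Qed.

Lemma pres_subst_zmod : zmod_morphism pres_subst.
Proof.
elim/pres_ind=> F; elim/pres_ind=> G.
by rewrite -raddfB !pres_subst_pi -raddfB -raddfB.
Qed.

Lemma pres_subst_monoid : monoid_morphism pres_subst.
Proof.
split; first by rewrite -[1]/(pres_pi relI 1) pres_subst_pi !rmorph1.
elim/pres_ind=> F; elim/pres_ind=> G.
by rewrite pres_rmulE !pres_subst_pi pres_rmulE rmorphM.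
Qed.

Lemma pres_subst_scalable : scalable pres_subst.
Proof.
move=> c; elim/pres_ind=> F.
by rewrite pres_scaleE !pres_subst_pi pres_scaleE linearZ.
Qed.

End Substitution.

Section Grading.
Variables (K : fieldType) (I : choiceType) (rel : set (free_alg K I)).

Definition free_homog (d : nat) (F : free_alg K I) : Prop :=
  forall w, w \in msupp F -> fdeg w = d.

Definition free_comp (d : nat) (F : free_alg K I) : free_alg K I :=
  \sum_(w <- msupp F | fdeg w == d) << F@_w *g w >>.

Definition homog (d : nat) (f : pres_alg rel) : Prop :=
  exists2 F, free_homog d F & f = pres_pi rel F.

(* Degree-d component, meaningful when the relations are homogeneous. *)
Definition hcomp (d : nat) (f : pres_alg rel) : pres_alg rel :=
  pres_pi rel (free_comp d (pres_repr f)).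

(* Extension by linearity of a family phi d of maps, phi d being relevant on
   elements homogeneous of degree d only (see hext_homog). *)
Definition hext (V : zmodType) (phi : nat -> pres_alg rel -> V)
    (f : pres_alg rel) : V :=
  \sum_(d < mmeasure (@fdeg I) (pres_repr f)) phi d (hcomp d f).

Lemma free_compE d F w : (free_comp d F)@_w = F@_w *+ (fdeg w == d).
Proof.
rewrite /free_comp raddf_sum /= big_mkcond /=.
have [wF|wF] := boolP (w \in msupp F); last first.
  rewrite (mcoeff_outdom wF) mul0rn big_seq big1 // => v vF.
  case: ifP => // _; rewrite mcoeffU; case: eqP => // e.
  by move: wF; rewrite -e vF.
rewrite (bigD1_seq w) ?fset_uniq //= big1 ?addr0.
  by rewrite mcoeffU eqxx; case: (_ == d).
by move=> v /negPf vw; rewrite mcoeffU vw mulr0n if_same.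
Qed.

Lemma free_comp_zmod d : zmod_morphism (free_comp d).
Proof.
move=> F G; apply/malgP => w.
by rewrite mcoeffB !free_compE mcoeffB mulrnBl.
Qed.
HB.instance Definition _ d := GRing.isZmodMorphism.Build (free_alg K I)
  (free_alg K I) (free_comp d) (free_comp_zmod d).

Lemma free_compU d c w : free_comp d << c *g w >> = << c *g w >> *+ (fdeg w == d).
Proof.
apply/malgP => v; rewrite free_compE mcoeffMn mcoeffU.
by case: eqP => [->//|_]; rewrite mulr0n !mul0rn.
Qed.

Lemma free_compMl d c w (G : free_alg K I) :
  free_comp d (<< c *g w >> * G) =
    if (fdeg w <= d)%N then << c *g w >> * free_comp (d - fdeg w) G else 0.
Proof.
have E H : << c *g w >> * H = \sum_(v <- msupp H) << c * H@_v *g mmul w v >>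
  by exact: fgmulUg.
have E' e : free_comp e G = \sum_(v <- msupp G) << G@_v *g v >> *+ (fdeg v == e).
  by rewrite {1}[G]monalgE raddf_sum; apply: eq_bigr => v _; exact: free_compU.
rewrite E raddf_sum /= E' mulr_sumr.
have [wd|wd] := leqP (fdeg w) d; last first.
  rewrite big1 // => v _; rewrite free_compU fdegM.
  by rewrite eqn_leq leqNgt ltn_addr // mulr0n.
apply: eq_bigr => v _; rewrite free_compU fdegM mulrnAr malgM_def fgmulUU.
by rewrite -[d in LHS](subnKC wd) eqn_add2l.
Qed.

Lemma free_compMr d c w (G : free_alg K I) :
  free_comp d (G * << c *g w >>) =
    if (fdeg w <= d)%N then free_comp (d - fdeg w) G * << c *g w >> else 0.
Proof.
have E H : H * << c *g w >> = \sum_(v <- msupp H) << H@_v * c *g mmul v w >>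
  by exact: fgmulgU.
have E' e : free_comp e G = \sum_(v <- msupp G) << G@_v *g v >> *+ (fdeg v == e).
  by rewrite {1}[G]monalgE raddf_sum; apply: eq_bigr => v _; exact: free_compU.
rewrite E raddf_sum /= E' mulr_suml.
have [wd|wd] := leqP (fdeg w) d; last first.
  rewrite big1 // => v _; rewrite free_compU fdegM.
  by rewrite eqn_leq leqNgt ltn_addl // mulr0n.
apply: eq_bigr => v _; rewrite free_compU fdegM mulrnAl malgM_def fgmulUU.
by rewrite -[d in LHS](subnK wd) eqn_add2r.
Qed.

Hypothesis rel_homog : forall r, rel r -> exists d, free_homog d r.

Lemma free_homog_comp d e F :
  free_homog d F -> free_comp e F = if e == d then F else 0.
Proof.
move=> hF; apply/malgP => w; rewrite free_compE.
have [wF|wF] := boolP (w \in msupp F); last first.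
  by rewrite (mcoeff_outdom wF) mul0rn; case: eqP; rewrite ?mcoeff0 ?mcoeff_outdom.
by rewrite (hF _ wF) eq_sym; case: eqP; rewrite ?mcoeff0.
Qed.

Lemma ideal_gen_comp d F : ideal_gen rel F -> ideal_gen rel (free_comp d F).
Proof.
have [h0 hD hl hr] := ideal_genP rel.
have hsum (T : Type) (s : seq T) (X : T -> free_alg K I) :
    (forall x, ideal_gen rel (X x)) -> ideal_gen rel (\sum_(x <- s) X x).
  by move=> hX; elim/big_rec: _ => [//|x y _]; exact: (hD _ _ (hX x)).
move=> hF.
refine (hF (fun G => forall d, ideal_gen rel (free_comp d G)) _ _ d).
  split=> [e|F1 F2 h1 h2 e|F1 G hG e|F1 G hG e].
  - by rewrite raddf0; exact: h0.
  - by rewrite raddfD; exact: (hD _ _ (h1 e) (h2 e)).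
  - rewrite [F1]monalgE mulr_suml raddf_sum; apply: hsum => w /=.
    rewrite free_compMl; case: ifP => _; last exact: h0.
    exact: (hl _ _ (hG _)).
  - rewrite [G]monalgE mulr_sumr raddf_sum; apply: hsum => w /=.
    rewrite free_compMr; case: ifP => _; last exact: h0.
    exact: (hr _ _ (hG _)).
move=> r rr e; have [d' hd'] := rel_homog rr.
rewrite (free_homog_comp _ hd'); case: eqP => _; last exact: h0.
by move=> J _; apply.
Qed.

Lemma hcomp_pi d F : hcomp d (pres_pi rel F) = pres_pi rel (free_comp d F).
Proof.
apply/pres_piP; rewrite -raddfB /=.
exact: (ideal_gen_comp d (ideal_gen_repr F)).
Qed.

Lemma hcomp_homog d e f : homog d f -> hcomp e f = if e == d then f else 0.
Proof.
case=> F hF ->; rewrite hcomp_pi (free_homog_comp _ hF).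
by case: eqP => _ //; rewrite raddf0.
Qed.

Lemma hext_homog (V : zmodType) (phi : nat -> pres_alg rel -> V) d f :
  (forall e, phi e 0 = 0) -> homog d f -> hext phi f = phi d f.
Proof.
move=> phi0 hf; rewrite /hext; set N := mmeasure _ _.
have [dN|Nd] := ltnP d N.
  rewrite (bigD1 (Ordinal dN)) //= (hcomp_homog _ hf) eqxx big1 ?addr0 //.
  by move=> e; rewrite -val_eqE (hcomp_homog _ hf) => /negPf /= ->; exact: phi0.
rewrite big1 => [|e _]; last first.
  by rewrite (hcomp_homog _ hf) ltn_eqF ?phi0 // (leq_trans (ltn_ord e)).
suff -> : f = 0 by rewrite phi0.
have <- : hcomp d f = f by rewrite (hcomp_homog _ hf) eqxx.
rewrite /hcomp (_ : free_comp d _ = 0) ?raddf0 //.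
apply/malgP => w; rewrite free_compE mcoeff0.
case: eqP => [wd|_]; rewrite ?mulr0n // mcoeff_outdom //.
apply: (mmeasure_mnm_ge (mf := @fdeg I)); rewrite -/N.
by change (N <= fdeg w)%N; rewrite wd.
Qed.

End Grading.

Section Localization.
Variables (K : fieldType) (I J : choiceType).
Variables (rel : set (free_alg K I)) (e : J -> free_alg K I).

Definition loc_lift : free_alg K I -> free_alg K (I + J)%type :=
  feval (fun i => fgen K (inl i)).

Definition loc_rel : set (free_alg K (I + J)%type) :=
  [set r | (exists2 r0, rel r0 & r = loc_lift r0) \/
           (exists j, r = loc_lift (e j) * fgen K (inr j) - 1 \/
                      r = fgen K (inr j) * loc_lift (e j) - 1)].

(* Localization of K<I>/(rel) at the classes of the e j: formal two-sided
   inverses (the generators inr j) are adjoined.  This is the universal algebra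
   inverting the e j, hence the Ore localization whenever the latter exists. *)
Definition loc_alg := pres_alg loc_rel.
HB.instance Definition _ := GRing.PzRing.on loc_alg.
HB.instance Definition _ := GRing.Lmodule.on loc_alg.

Definition loc_map : pres_alg rel -> loc_alg :=
  pres_subst loc_rel (fun i => fgen K (inl i)).

Lemma loc_map_rel r : rel r -> ideal_gen loc_rel (loc_lift r).
Proof. by move=> hr H _; apply; left; exists r. Qed.

HB.instance Definition _ := GRing.isZmodMorphism.Build (pres_alg rel) loc_alg
  loc_map (pres_subst_zmod loc_map_rel).
HB.instance Definition _ := GRing.isMonoidMorphism.Build (pres_alg rel) loc_alg
  loc_map (pres_subst_monoid loc_map_rel).
HB.instance Definition _ := GRing.isScalable.Build K (pres_alg rel) loc_alg
  *:%R loc_map (pres_subst_scalable loc_map_rel).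

End Localization.

(* The two-sided inverse of y if there is one, and 0 otherwise. *)
Definition inv_or0 (A : pzRingType) (y : A) : A :=
  xget 0 [set z | z * y = 1 /\ y * z = 1]%classic.

Lemma inv_or0_eq (A : pzRingType) (y z : A) :
  z * y = 1 -> y * z = 1 -> inv_or0 y = z.
Proof.
move=> zy yz; rewrite /inv_or0; case: xgetP => [z' _ [z'y _]|/(_ z) []] //.
by rewrite -[z']mulr1 -yz mulrA z'y mul1r.
Qed.

Section SkewPolynomials.
Variables (K : fieldType) (n : nat).

Definition skew_rel : set (free_alg K 'I_n) :=
  [set r | exists i j : 'I_n,
     i != j /\ r = fgen K i * fgen K j + fgen K j * fgen K i].

Definition skewpoly := pres_alg skew_rel.
HB.instance Definition _ := GRing.PzRing.on skewpoly.
HB.instance Definition _ := GRing.Lmodule.on skewpoly.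

Definition skewX (i : 'I_n) : skewpoly := pgen skew_rel i.
Local Notation x := skewX.

(* Algebra morphisms (instances below); swapX and tauX give their values on
   generators. *)
Definition swap (i k : 'I_n) : skewpoly -> skewpoly :=
  pres_subst skew_rel (fun j : 'I_n => fgen K (tperm i k j : 'I_n)).

Definition tau (i : 'I_n) : skewpoly -> skewpoly :=
  pres_subst skew_rel (fun j : 'I_n => if j == i then - fgen K j else fgen K j).

Definition denom (j : 'I_n + {p : 'I_n * 'I_n | p.1 != p.2}) : free_alg K 'I_n :=
  match j with
  | inl i => fgen K i
  | inr p => fgen K (val p).1 ^+ 2 - fgen K (val p).2 ^+ 2
  end.

Definition skewloc := loc_alg skew_rel denom.
HB.instance Definition _ := GRing.PzRing.on skewloc.
HB.instance Definition _ := GRing.Lmodule.on skewloc.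

Definition skewloc_map : skewpoly -> skewloc := @loc_map _ _ _ skew_rel denom.
Local Notation iota := skewloc_map.

(* The skew polynomial with image y in the localization (junk value 0 if there
   is none).  skewloc_map is injective, and the operators below apply descend
   only to elements of its image, where it is the inverse of skewloc_map. *)
Definition descend (y : skewloc) : skewpoly := xget 0 [set f | iota f = y]%classic.

Definition delta (i : 'I_n) (f : skewpoly) : skewpoly :=
  descend (inv_or0 (iota (2%:R * x i)) * iota (f - tau i f)).

(* d stands for the degree of f. *)
Definition odiff_loc (i k : 'I_n) (d : nat) (f : skewpoly) : skewloc :=
  inv_or0 (iota (x k ^+ 2 - x i ^+ 2)) *
    iota ((x k - x i) * f - (-1) ^+ d * swap i k f * (x k - x i)).

Definition odiff (i k : 'I_n) (f : skewpoly) : skewpoly :=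
  descend (hext (odiff_loc i k) f).

Definition eta (t u : K) (i : 'I_n) (f : skewpoly) : skewpoly :=
  descend (t *: iota (delta i f) +
    u *: \sum_(k < n | k != i)
           inv_or0 (iota (x i ^+ 2 - x k ^+ 2)) *
           iota ((x i - x k) * swap i k f - x i * tau i f + x k * tau k f)).

Lemma skew_rel_homog r : skew_rel r -> exists d, free_homog d r.
Proof.
case=> i [j [_ ->]]; exists 2%N => w.
rewrite /fgen !malgM_def !fgmulUU => /(fsubsetP (msuppD_le _ _)).
rewrite inE => /orP[] /(fsubsetP msuppU_le); rewrite inE => /eqP ->;
  by rewrite fdegM !fdegU.
Qed.

Lemma skewX_anticomm i j : i != j -> x i * x j + x j * x i = 0.
Proof.
move=> ij; rewrite /skewX /pgen !pres_rmulE -pres_piD -(raddf0 (@pres_pi K _ skew_rel)).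
by apply/pres_piP; rewrite subr0 => J _; apply; exists i, j.
Qed.

Lemma swap_rel i k r : skew_rel r ->
  ideal_gen skew_rel (feval (fun j : 'I_n => fgen K (tperm i k j : 'I_n)) r).
Proof.
case=> a [b [ab ->]] J _; apply; exists (tperm i k a), (tperm i k b).
split; first by rewrite (inj_eq perm_inj).
by rewrite feval_anticomm.
Qed.

Lemma tau_rel i r : skew_rel r ->
  ideal_gen skew_rel
    (feval (fun j : 'I_n => if j == i then - fgen K j else fgen K j) r).
Proof.
case=> a [b [ab ->]] J [_ _ hl _] hJ.
have hab : J (fgen K a * fgen K b + fgen K b * fgen K a).
  by apply: hJ; exists a, b.
rewrite feval_anticomm.
move: (fgen K a) (fgen K b) hab => F G hFG.
case: (a == i); case: (b == i).
- by rewrite !mulrNN.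
- by rewrite mulNr mulrN -opprD -mulN1r; exact: hl.
- by rewrite mulrN mulNr -opprD -mulN1r; exact: hl.
- exact: hFG.
Qed.

HB.instance Definition _ i k := GRing.isZmodMorphism.Build skewpoly skewpoly
  (swap i k) (pres_subst_zmod (@swap_rel i k)).
HB.instance Definition _ i k := GRing.isMonoidMorphism.Build skewpoly skewpoly
  (swap i k) (pres_subst_monoid (@swap_rel i k)).
HB.instance Definition _ i k := GRing.isScalable.Build K skewpoly skewpoly
  *:%R (swap i k) (pres_subst_scalable (@swap_rel i k)).
HB.instance Definition _ i := GRing.isZmodMorphism.Build skewpoly skewpoly
  (tau i) (pres_subst_zmod (@tau_rel i)).
HB.instance Definition _ i := GRing.isMonoidMorphism.Build skewpoly skewpoly
  (tau i) (pres_subst_monoid (@tau_rel i)).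
HB.instance Definition _ i := GRing.isScalable.Build K skewpoly skewpoly
  *:%R (tau i) (pres_subst_scalable (@tau_rel i)).

Lemma swapX i k j : swap i k (x j) = x (tperm i k j).
Proof. exact: (pres_subst_gen (@swap_rel i k)). Qed.

Lemma tauX i j : tau i (x j) = if j == i then - x j else x j.
Proof.
rewrite /tau /skewX (pres_subst_gen (@tau_rel i)).
by case: eqP => _ //; rewrite raddfN.
Qed.

Lemma odiffE i k d f :
  homog d f -> odiff i k f = descend (odiff_loc i k d f).
Proof.
move=> hf; rewrite /odiff (hext_homog skew_rel_homog _ hf) // => e.
by rewrite /odiff_loc [swap i k 0]raddf0 !(mulr0, mul0r) subrr [iota 0]raddf0 mulr0.
Qed.

End SkewPolynomials.

Arguments skewX {K n} i.

(* Main.v *)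
From HB Require Import structures.
Require Import Defs.
From mathcomp Require Import all_boot all_order all_algebra perm.
From mathcomp Require Import finmap boolp classical_sets reals complex.
From mathcomp.multinomials Require Import monalg.

Set Implicit Arguments.
Unset Strict Implicit.
Unset Printing Implicit Defensive.

Import GRing.Theory Num.Theory.
Local Open Scope ring_scope.

(** Write s, p and q for the images of f under the swap s_(i,k), tau_i and
tau_k.  If f is homogeneous of degree d then (-1)^d f x_j = x_j tau_j(f)
([homogX_comm]): moving x_j leftwards through a monomial costs one sign for
each letter other than x_j.  Since the swap is an involution, the numerator of
the divided difference of s is therefore
  (x_k - x_i) s - x_k q + x_i p = - [(x_i - x_k) s - x_i p + x_k q],
and its denominator x_k^2 - x_i^2 is also the opposite of the one in the Dunkl
operator, so the two fractions agree in the localization.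

To bring this equality back to skew polynomials two things are needed.  First,
the fractions must lie in the image of the skew polynomial ring: the bracket
above is divisible by the central element x_i^2 - x_k^2, by induction on
monomials using a twisted Leibniz rule ([eta_numeratorMX],
[eta_numerator_dvd]).  Second, the map to the localization must be injective
([skewloc_map_inj]).  The localization is given by generators and relations, so
an element that it kills is killed by every representation in which the
denominators become invertible ([loc_map_eq0]).  Such representations are
x_j |-> a_j gamma_j, with gamma_j Clifford generators and a_j nonzero scalars
with distinct squares: then x_j^2 acts as the scalar a_j^2.  For the choice
a_j = p_j^m with p_j the j-th of a list of distinct primes, a word w acts on a
suitable vector as +- c(w)^m, where c(w) is the product of the primes of its
letters.  By unique factorization c(w) determines w up to reordering, hence its
class up to sign, and letting m vary separates the values c(w)
([power_sums_vanish]), so a skew polynomial killed by all these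
representations is zero. *)

(** * Words in anticommuting letters *)

(** The sign depends on the two words only, not on the ring nor on the letters:
the same sign thus relates the two words in the skew polynomial ring and in the
Clifford algebra. *)
Lemma anticomm_perm (I : eqType) (w w' : seq I) : perm_eq w w' ->
  exists b : bool, forall (A : pzRingType) (h : I -> A),
    (forall i j, i != j -> h i * h j = - (h j * h i)) ->
    \prod_(i <- w) h i = (-1) ^+ b * \prod_(i <- w') h i.
Proof.
have move_front (j : I) v : j \in v ->
    exists b : bool, forall (A : pzRingType) (h : I -> A),
      (forall i k, i != k -> h i * h k = - (h k * h i)) ->
      \prod_(i <- v) h i = (-1) ^+ b * (h j * \prod_(i <- rem j v) h i).
  elim: v => [//|i v IHv]; rewrite inE eq_sym /=.
  case: eqVneq => [->|ij] /= => [_|/IHv [b Eb]].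
    by exists false => A h _; rewrite mul1r big_cons.
  exists (~~ b) => A h hh; rewrite !big_cons (Eb _ _ hh).
  rewrite [LHS]mulrA (commr_sign (h i) b) -mulrA (mulrA (h i)) hh //.
  by rewrite signrN !mulNr mulrN !mulrA.
elim: w w' => [|j w IHw] w'.
  by rewrite perm_sym => /perm_nilP ->; exists false => A h _; rewrite mul1r.
move=> jww'; have jw' : j \in w' by rewrite -(perm_mem jww') mem_head.
have [b' Eb'] := move_front _ _ jw'.
have [b Eb] : exists b : bool, forall (A : pzRingType) (h : I -> A),
    (forall i j, i != j -> h i * h j = - (h j * h i)) ->
    \prod_(i <- w) h i = (-1) ^+ b * \prod_(i <- rem j w') h i.
  by apply: IHw; rewrite -(perm_cons j) (perm_trans jww') // perm_to_rem.
exists (b (+) b') => A h hh; rewrite big_cons (Eb _ _ hh) (Eb' _ _ hh).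
by rewrite [LHS]mulrA (commr_sign (h j) b) !mulrA -signr_addb addbK.
Qed.

(** Evaluating the vanishing power sums on a polynomial without constant term
that vanishes at all values of q but one isolates the sum of d over a fibre of
q; y is constant on such a fibre. *)
Lemma power_sums_vanish (K : fieldType) (V : lmodType K) (T : eqType)
    (s : seq T) (q d : T -> K) (y : T -> V) :
  (forall w, q w != 0) ->
  (forall w w', q w = q w' -> y w = y w') ->
  (forall m, \sum_(w <- s) d w * q w ^+ m.+1 = 0) ->
  \sum_(w <- s) d w *: y w = 0.
Proof.
move=> q0 qy dq0.
have dP0 (P : {poly K}) : \sum_(w <- s) d w * (q w * P.[q w]) = 0.
  under eq_bigr => w _ do rewrite horner_coef !mulr_sumr.
  rewrite exchange_big /= big1 // => m _.
  under eq_bigr => w _ do rewrite [q w * _]mulrCA -exprS mulrCA.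
  by rewrite -mulr_sumr dq0 mulr0.
pose vals := undup [seq q w | w <- s].
have class_sum (w0 : T) : \sum_(w <- s | q w == q w0) d w = 0.
  (* 'X * P is, up to a factor, the Lagrange polynomial of q w0. *)
  pose P := \prod_(r <- vals | r != q w0) ('X - r%:P).
  have Pw w : w \in s -> q w != q w0 -> P.[q w] = 0.
    move=> sw qww0; rewrite /P big_mkcond (big_rem (q w)) /=; last first.
      by rewrite mem_undup map_f.
    by rewrite qww0 hornerM hornerXsubC subrr mul0r.
  have Pw0 : P.[q w0] != 0.
    rewrite /P horner_prod; elim/big_rec: _ => [|r z rq z0]; first exact: oner_neq0.
    by rewrite mulf_neq0 // hornerXsubC subr_eq0 eq_sym.
  apply: (mulIf (mulf_neq0 (q0 w0) Pw0)); rewrite mul0r mulr_suml -[RHS](dP0 P).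
  rewrite big_mkcond /= big_seq [RHS]big_seq; apply: eq_bigr => w sw.
  by case: eqVneq => [->//|qw]; rewrite Pw ?mulr0.
have -> : \sum_(w <- s) d w *: y w =
    \sum_(r <- vals) \sum_(w <- s | q w == r) d w *: y w.
  rewrite (exchange_big_dep predT) //= big_seq [RHS]big_seq.
  apply: eq_bigr => w sw; under eq_bigl => r do rewrite eq_sym.
  by rewrite big_const_seq iter_addr_0 -[in RHS]/(count_mem _ _)
       count_uniq_mem ?undup_uniq // mem_undup map_f.
rewrite big_seq big1 // => r; rewrite mem_undup => /mapP[w0 _ ->].
under eq_bigr => w /eqP qw do rewrite (qy _ _ qw).
by rewrite -scaler_suml class_sum scale0r.
Qed.

(** * The Clifford representation *)

Section Clifford.
Variables (K : fieldType) (n : nat).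

Local Notation cube := {ffun 'I_n -> bool}.
Local Notation V := {ffun cube -> K^o}.

Definition flip (j : 'I_n) (S : cube) : cube := [ffun i => S i (+) (i == j)].

(** The Jordan-Wigner sign: it turns the commuting flips of the coordinates of
the cube into anticommuting operators. *)
Definition below_sign (j : 'I_n) (S : cube) : K :=
  \prod_(i < n | (i < j)%N) (-1) ^+ S i.

Lemma flipC j k S : flip j (flip k S) = flip k (flip j S).
Proof. by apply/ffunP => i; rewrite !ffunE addbAC. Qed.

Lemma flipK j : involutive (flip j).
Proof. by move=> S; apply/ffunP => i; rewrite !ffunE addbK. Qed.

Lemma below_sign_flip j k S :
  below_sign j (flip k S) = (-1) ^+ (k < j)%N * below_sign j S.
Proof.
rewrite /below_sign mulrC.
under eq_bigr => i _ do rewrite ffunE signr_addb.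
rewrite big_split /=; congr (_ * _).
case: (ltnP k j) => [kj|jk].
  rewrite (bigD1 k) //= eqxx big1 ?mulr1 // => i /andP[_ /negPf ->].
  by rewrite expr0.
rewrite big1 ?expr0 // => i ij; case: eqP => // ik.
by move: ij; rewrite ik ltnNge jk.
Qed.

Lemma below_sign_sqr j S : below_sign j S * below_sign j S = 1.
Proof.
rewrite /below_sign -big_split big1 // => i _ /=.
by rewrite -expr2 sqrr_sign.
Qed.

Definition clifford_fun (j : 'I_n) (phi : V) : V :=
  [ffun S => below_sign j S *: phi (flip j S)].

Lemma clifford_fun_linear j : linear (clifford_fun j).
Proof.
move=> c phi psi; apply/ffunP => S.
by rewrite !ffunE scalerDr !scalerA (mulrC c).
Qed.
HB.instance Definition _ j :=
  GRing.isLinear.Build K V V *:%R (clifford_fun j) (clifford_fun_linear j).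

Lemma cube_space_proper : (0 < dim V)%N.
Proof.
by rewrite muln_gt0 andbT; apply/card_gt0P; exists [ffun => false].
Qed.

Definition clifford_alg : algType K := lfun_algType cube_space_proper.

Definition clifford (j : 'I_n) : clifford_alg := linfun (clifford_fun j).

Lemma clifford_mulE (f g : clifford_alg) (phi : V) :
  (f * g : 'End(V)) phi = (g : 'End(V)) ((f : 'End(V)) phi).
Proof. exact: comp_lfunE. Qed.

Lemma cliffordE j phi S :
  (clifford j : 'End(V)) phi S = below_sign j S * phi (flip j S).
Proof. by rewrite lfunE ffunE. Qed.

Lemma clifford_anticomm j k :
  j != k -> clifford j * clifford k = - (clifford k * clifford j).
Proof.
move=> jk; apply/lfunP => phi; rewrite opp_lfunE !clifford_mulE.
apply/ffunP => S; rewrite ffunE !cliffordE flipC !below_sign_flip.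
have -> : (-1) ^+ (j < k)%N = - (-1) ^+ (k < j)%N :> K.
  case: ltngtP jk => [_ _|_ _|/val_inj ->]; by rewrite ?eqxx ?opprK.
rewrite !mulNr mulrN opprK -!mulrA.
by rewrite mulrCA [in RHS]mulrCA; congr (_ * _); rewrite mulrCA.
Qed.

Lemma clifford_sqr j : clifford j * clifford j = 1.
Proof.
apply/lfunP => phi; rewrite clifford_mulE id_lfunE.
apply/ffunP => S; rewrite !cliffordE flipK below_sign_flip ltnn mul1r.
by rewrite mulrA below_sign_sqr mul1r.
Qed.

(** The constant function 1 is sent by any word to a function with values 1 and
-1; the coordinate at the origin of the cube is enough to recover the sign by
which two reorderings of a word differ. *)
Definition clifford_sign (w : seq 'I_n) : K :=
  (\prod_(j <- w) clifford j : 'End(V)) [ffun=> 1] [ffun=> false].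

Lemma clifford_sign_sqr w : clifford_sign w * clifford_sign w = 1.
Proof.
rewrite /clifford_sign; move: [ffun => false]; set phi := finfun _.
have : forall S, phi S * phi S = 1 by move=> S; rewrite ffunE mulr1.
move: phi; elim: w => [|j w IHw] phi phi1 S.
  by rewrite big_nil id_lfunE.
rewrite big_cons clifford_mulE; apply: IHw => S'.
by rewrite cliffordE mulrACA below_sign_sqr phi1 mulr1.
Qed.
End Clifford.

(** * Elements killed by a localization *)

Section KernelOfLocalization.
Variables (K : fieldType) (I J : choiceType).
Variables (rel : set (free_alg K I)) (e : J -> free_alg K I).
Variables (A : algType K) (h : I -> A) (g : J -> A).

Lemma feval_loc_lift F :
  feval (fun z : I + J => match z with inl i => h i | inr j => g j end)
    (loc_lift J F) = feval h F.
Proof.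
set k := fun z : I + J => _.
have kU w : feval k (word_eval (fun i => fgen K (inl i)) w) = word_eval h w.
  rewrite /word_eval rmorph_prod; apply: eq_bigr => i _; exact: feval_gen.
rewrite /loc_lift {2}/feval mmapE raddf_sum /=.
rewrite {2}/feval mmapE; apply: eq_bigr => w _.
by rewrite !mulr_algl linearZ /= kU.
Qed.

Hypothesis h_rel : forall r, rel r -> feval h r = 0.
Hypothesis g_inv : forall j,
  feval h (e j) * g j = 1 /\ g j * feval h (e j) = 1.

(** A representation of the presented algebra that inverts the denominators
extends to the localization. *)
Lemma loc_map_eq0 F : loc_map e (pres_pi rel F) = 0 -> feval h F = 0.
Proof.
rewrite /loc_map (pres_subst_pi (@loc_map_rel K I J rel e)).
rewrite -(raddf0 (@pres_pi K _ (loc_rel rel e))) => /pres_piP; rewrite subr0 => hF.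
rewrite -feval_loc_lift; set k := fun z : I + J => _.
have fevalB1 G : feval k (G - 1) = feval k G - 1 by rewrite rmorphB rmorph1.
apply: (hF [set G | feval k G = 0]%classic); first split=> /=.
- exact: raddf0.
- by move=> F1 F2 E1 E2; rewrite fevalD E1 E2 addr0.
- by move=> F1 F2 E2; rewrite fevalM E2 mulr0.
- by move=> F1 F2 E1; rewrite fevalM E1 mul0r.
move=> r [[r0 rr0 ->]|[j [->|->]]] /=.
- by rewrite feval_loc_lift h_rel.
- by rewrite fevalB1 fevalM feval_loc_lift feval_gen (g_inv j).1 subrr.
- by rewrite fevalB1 fevalM feval_loc_lift feval_gen (g_inv j).2 subrr.
Qed.
End KernelOfLocalization.

(** * Expansion in words *)

Lemma prod_fgen (K : fieldType) (I : choiceType) (w : seq I) :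
  \prod_(i <- w) fgen K i = << FMonom w >>.
Proof.
elim: w => [|i w IHw].
  by rewrite big_nil; congr (<< _ >>); apply: val_inj; rewrite /= fm1.
rewrite big_cons IHw malgM_def fgmulUU mulr1; congr (<< _ >>).
by apply: val_inj; rewrite /= fmM fmU.
Qed.

Lemma free_word_decomposition (K : fieldType) (I : choiceType) (F : free_alg K I) :
  F = \sum_(w <- msupp F) F@_w *: \prod_(i <- (w : seq I)) fgen K i.
Proof.
rewrite {1}[F]monalgE; apply: eq_bigr => -[w] _; rewrite prod_fgen.
by apply/malgP => v; rewrite mcoeffZ !mcoeffU mulrnAr mulr1.
Qed.

Lemma pres_pi_word_decomposition (K : fieldType) (I : choiceType)
    (rel : set (free_alg K I)) (F : free_alg K I) :
  pres_pi rel F = \sum_(w <- msupp F) F@_w *: \prod_(i <- (w : seq I)) pgen rel i.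
Proof.
rewrite {1}[F]free_word_decomposition raddf_sum /=; apply: eq_bigr => w _.
by rewrite linearZ rmorph_prod.
Qed.

(** * Coding words by integers *)

Fixpoint increasing_prime (k : nat) : nat :=
  if k is k'.+1 then s2val (prime_above (increasing_prime k')) else 2.

Lemma increasing_prime_prime k : prime (increasing_prime k).
Proof. by case: k => [|k] //=; case: prime_above. Qed.

Lemma increasing_prime_inj : injective increasing_prime.
Proof.
have mono : {homo increasing_prime : j k / (j < k)%N}.
  by apply: homo_ltn => [? ? ?|k /=]; [exact: ltn_trans|case: prime_above].
move=> j k jk; apply/eqP; case: ltngtP => // /mono; rewrite jk ltnn //.
Qed.

Definition word_code (n : nat) (w : seq 'I_n) : nat :=
  (\prod_(j <- w) increasing_prime j)%N.

Lemma word_code_gt0 n (w : seq 'I_n) : (0 < word_code w)%N.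
Proof. by apply: prodn_gt0 => j; apply: prime_gt0; exact: increasing_prime_prime. Qed.

(** Unique factorization: the multiplicity of a letter is the valuation of the
code at the corresponding prime. *)
Lemma word_code_perm n (w w' : seq 'I_n) :
  word_code w = word_code w' -> perm_eq w w'.
Proof.
have codeE (v : seq 'I_n) (j : 'I_n) : logn (increasing_prime j) (word_code v) = count_mem j v.
  elim: v => [|k v IHv]; first by rewrite /word_code big_nil logn1.
  rewrite /word_code big_cons lognM ?(prime_gt0 (increasing_prime_prime _)) //;
    last exact: word_code_gt0.
  rewrite logn_prime ?increasing_prime_prime // -/(word_code v) IHv /=.
  by rewrite (inj_eq increasing_prime_inj) (inj_eq val_inj) eq_sym.
by move=> ww'; apply/allP => j _ /=; rewrite -!codeE ww'.
Qed.

(** * Injectivity of the localization map *)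

Section FaithfulLocalization.
Variables (K : numFieldType) (n : nat).

Lemma skew_anticomm (j k : 'I_n) : j != k ->
  (skewX j : skewpoly K n) * skewX k = - (skewX k * skewX j).
Proof. by move=> jk; apply/eqP; rewrite -subr_eq0 opprK skewX_anticomm. Qed.

(** In this representation x_j^2 acts as the scalar a_j^2, so x_j and
x_j^2 - x_k^2 act invertibly. *)
Lemma scaled_clifford_vanish (a : 'I_n -> K) (F : free_alg K 'I_n) :
  (forall j, a j != 0) -> (forall j k, j != k -> a j ^+ 2 != a k ^+ 2) ->
  skewloc_map (pres_pi (@skew_rel K n) F) = 0 ->
  feval (fun j => a j *: clifford K j) F = 0.
Proof.
move=> a0 asq; set h := fun j => _.
have mulZ (c d : K) (x y : clifford_alg K n) :
    (c *: x) * (d *: y) = (c * d) *: (x * y).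
  by rewrite -scalerAl -scalerAr scalerA.
have hsq j : feval h (fgen K j ^+ 2) = a j ^+ 2 *: 1.
  by rewrite fevalM feval_gen mulZ clifford_sqr.
pose g (z : 'I_n + {p : 'I_n * 'I_n | p.1 != p.2}) : clifford_alg K n :=
  match z with
  | inl j => (a j)^-1 *: clifford K j
  | inr p => (a (val p).1 ^+ 2 - a (val p).2 ^+ 2)^-1 *: 1
  end.
apply: (loc_map_eq0 (g := g)) => [r [j [k [jk ->]]]|[j|[[j k] /= jk]]].
- rewrite feval_anticomm !mulZ clifford_anticomm //.
  by rewrite scalerN (mulrC (a k)) addNr.
- by rewrite feval_gen !mulZ clifford_sqr mulfV // mulVf // scale1r.
have -> : feval h (fgen K j ^+ 2 - fgen K k ^+ 2) = (a j ^+ 2 - a k ^+ 2) *: 1.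
  by rewrite scalerBl -!hsq; exact: raddfB.
have jk0 : a j ^+ 2 - a k ^+ 2 != 0 by rewrite subr_eq0 asq.
by rewrite !mulZ mulr1 mulfV // mulVf // scale1r.
Qed.

Lemma skew_words_same_code (w w' : seq 'I_n) :
  word_code w = word_code w' ->
  clifford_sign K w *: \prod_(j <- w) (skewX j : skewpoly K n) =
  clifford_sign K w' *: \prod_(j <- w') (skewX j : skewpoly K n).
Proof.
move=> /word_code_perm/anticomm_perm [b Eb].
rewrite (Eb _ _ skew_anticomm).
rewrite /clifford_sign (Eb _ _ (@clifford_anticomm K n)).
by case: b {Eb}; rewrite ?mul1r // !mulN1r opp_lfunE ffunE scalerN scaleNr opprK.
Qed.

(** A word acts on the constant function 1, read at the origin, as its sign times
a power of its code, and every positive exponent can be realized. *)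
Lemma skewloc_map_inj : injective (@skewloc_map K n).
Proof.
move=> f1 f2 /eqP; rewrite -subr_eq0 -raddfB /= => /eqP f12.
apply/eqP; rewrite -subr_eq0; apply/eqP; move: (f1 - f2) f12 => {f1 f2}.
elim/pres_ind => F F0; rewrite pres_pi_word_decomposition.
pose d (w : {fmonom 'I_n}) := F@_w * clifford_sign K w.
pose y (w : {fmonom 'I_n}) :=
  clifford_sign K w *: \prod_(j <- (w : seq _)) (skewX j : skewpoly K n).
transitivity (\sum_(w <- msupp F) d w *: y w).
  by apply: eq_bigr => w _; rewrite /d /y scalerA -mulrA clifford_sign_sqr mulr1.
pose q (w : {fmonom 'I_n}) : K := (word_code (w : seq _))%:R.
apply: (@power_sums_vanish K _ _ _ q d y) => [w|w w'|m].
- by rewrite pnatr_eq0 -lt0n word_code_gt0.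
- by move/eqP; rewrite eqr_nat => /eqP; exact: skew_words_same_code.
(* The exponent is positive so that the scalars a j have distinct squares. *)
pose a (j : 'I_n) : K := (increasing_prime j)%:R ^+ m.+1.
have a0 j : a j != 0.
  by rewrite expf_neq0 // pnatr_eq0 -lt0n prime_gt0 ?increasing_prime_prime.
have asq j k : j != k -> a j ^+ 2 != a k ^+ 2.
  rewrite /a -!exprM -!natrX eqr_nat eqn_exp2r ?muln_gt0 //.
  by rewrite (inj_eq increasing_prime_inj).
have := scaled_clifford_vanish a0 asq F0.
rewrite /feval mmapE => /lfunP/(_ [ffun=> 1])/ffunP/(_ [ffun=> false]).
rewrite zero_lfunE ffunE sum_lfunE => E; rewrite -[RHS]E sum_ffunE.
apply: eq_bigr => w _; rewrite /= mulr_algl.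
rewrite /word_eval scaler_prod scalerA scale_lfunE ffunE.
rewrite /d -mulrA [_ * _%:R ^+ _]mulrC mulrA /clifford_sign.
congr (_ * _ * _).
by rewrite /word_code natr_prod prodrXl.
Qed.
End FaithfulLocalization.

(** * Identities for a pair of anticommuting elements *)

Section AnticommutingPair.
Variables (A : pzRingType) (a b : A).

Lemma sqr_comm_anticomm : a * b = - (b * a) -> a ^+ 2 * b = b * a ^+ 2.
Proof. by move=> ab; rewrite !expr2 -mulrA ab mulrN mulrA ab mulNr opprK mulrA. Qed.

(** The bracket of the odd Dunkl operator, for a = x_i and b = x_k: the arguments
stand for the images of a polynomial under the swap, tau_i and tau_k. *)
Definition twist (s p q : A) : A := (a - b) * s - a * p + b * q.

Lemma twistM_other (c s p q : A) : a * c = - (c * a) -> b * c = - (c * b) ->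
  twist (c * s) (c * p) (c * q) = - (c * twist s p q).
Proof.
move=> ac bc; rewrite /twist mulrDr mulrBr mulrBl mulrBl mulrBr !mulrA ac bc.
by rewrite !mulNr !opprD !opprK.
Qed.

Lemma twistM_left (s p q : A) : b * a = - (a * b) ->
  twist (b * s) (- a * p) (a * q) = - (a * twist s p q) + (a ^+ 2 - b ^+ 2) * s.
Proof.
move=> ba; rewrite /twist !expr2 mulrDr mulrBr !mulrBl mulrBr !mulrA ba.
rewrite mulrN !mulNr !opprD !opprK.
rewrite [RHS]addrA [RHS](ACl (1*5*2*6*3*4)%AC) /=.
by rewrite addNr add0r.
Qed.

Lemma twistM_right (s p q : A) : b * a = - (a * b) ->
  twist (a * s) (b * p) (- b * q) = - (b * twist s p q) + (a ^+ 2 - b ^+ 2) * s.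
Proof.
move=> ba; rewrite /twist !expr2 mulrDr mulrBr !mulrBl mulrBr !mulrA ba.
rewrite mulrN !mulNr !opprD !opprK.
by rewrite [RHS]addrA [RHS](ACl (5*1*3*4*2*6)%AC) /= addrK.
Qed.

Lemma twist1 : twist 1 1 1 = 0.
Proof. by rewrite /twist !mulr1 addrAC subrK subrr. Qed.

Lemma twistD (s p q s' p' q' : A) :
  twist (s + s') (p + p') (q + q') = twist s p q + twist s' p' q'.
Proof.
rewrite /twist !mulrDr opprD !addrA.
by rewrite [LHS](ACl (1*3*5*2*4*6)%AC).
Qed.

(** In the application e is the sign given by the degree of g. *)
Lemma twist_odd_difference (e g s p q : A) :
  e * g * a = a * p -> e * g * b = b * q ->
  (b - a) * s - e * g * (b - a) = - twist s p q.
Proof.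
move=> ga gb; rewrite mulrBr ga gb /twist -(opprB a b) mulNr.
by rewrite !opprD !opprK addrA addrAC.
Qed.

End AnticommutingPair.

Lemma inv_or0N (A : pzRingType) (y z : A) :
  z * y = 1 -> y * z = 1 -> inv_or0 (- y) = - z.
Proof. by move=> zy yz; apply: inv_or0_eq; rewrite mulrNN. Qed.

(** * Odd divided differences and the odd Dunkl operator *)

Section OddDividedDifferences.
Variables (K : numFieldType) (n : nat).
Local Notation P := (skewpoly K n).
Local Notation x := (@skewX K n).
Local Notation iota := (@skewloc_map K n).

Lemma skew_ind (Q : P -> Prop) :
  Q 1 -> (forall j f, Q f -> Q (x j * f)) ->
  (forall c f g, Q f -> Q g -> Q (c *: f + g)) ->
  forall f, Q f.
Proof.
move=> Q1 QX QD; elim/pres_ind => F; rewrite pres_pi_word_decomposition.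
have Q0 : Q 0 by have := QD (-1) _ _ Q1 Q1; rewrite scaleN1r addNr.
elim/big_rec: _ => [//|w g _ Qg]; apply: QD => //.
by elim: (w : seq _) => [|j v IHv]; rewrite ?big_nil ?big_cons //; exact: QX.
Qed.

Lemma swapM i k (f g : P) : swap i k (f * g) = swap i k f * swap i k g.
Proof. exact: rmorphM. Qed.

Lemma swapP i k c (f g : P) :
  swap i k (c *: f + g) = c *: swap i k f + swap i k g.
Proof. exact: linearP. Qed.

Lemma tauM i (f g : P) : tau i (f * g) = tau i f * tau i g.
Proof. exact: rmorphM. Qed.

Lemma tauP i c (f g : P) : tau i (c *: f + g) = c *: tau i f + tau i g.
Proof. exact: linearP. Qed.

Lemma sqrX_central k f : x k ^+ 2 * f = f * x k ^+ 2.
Proof.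
elim/skew_ind: f => [|j f IHf|c f g IHf IHg]; first by rewrite mulr1 mul1r.
  have kj : x k ^+ 2 * x j = x j * x k ^+ 2.
    have [->|kj] := eqVneq k j; first exact: (esym (commrX 2 (erefl _))).
    exact: (sqr_comm_anticomm (skew_anticomm K kj)).
  by rewrite mulrA kj -mulrA IHf mulrA.
by rewrite mulrDr mulrDl IHg -pres_scaleAr -pres_scaleAl IHf.
Qed.

(** Moving x_k leftwards through a word costs one sign for each letter other than
x_k; multiplied by (-1)^d this leaves one sign for each letter x_k, which is the
action of tau_k. *)
Lemma homogX_comm d k f :
  homog d f -> (-1) ^+ d * f * x k = x k * tau k f.
Proof.
case=> F hF ->; rewrite pres_pi_word_decomposition.
rewrite raddf_sum !(mulr_sumr, mulr_suml) /= big_seq [RHS]big_seq.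
apply: eq_bigr => w wF; rewrite -(hF w wF) linearZ /= -!pres_scaleAr -pres_scaleAl.
congr (_ *: _); rewrite /fdeg; elim: (w : seq _) => {wF} [|j v IHv].
  by rewrite big_nil expr0 !mul1r rmorph1 mulr1.
rewrite big_cons tauM.
have kj : x k * tau k (x j) = - (x j * x k).
  rewrite tauX; have [->|jk] := eqVneq j k; first by rewrite mulrN.
  by apply: skew_anticomm; rewrite eq_sym.
rewrite [RHS]mulrA kj mulNr -[in RHS]mulrA -IHv exprS mulN1r !mulNr.
by rewrite !mulrA -(commr_sign (x j)).
Qed.

Definition eta_numerator (i k : 'I_n) (f : P) : P :=
  twist (x i) (x k) (swap i k f) (tau i f) (tau k f).

Lemma eta_numerator_linear i k : linear (eta_numerator i k).
Proof.
move=> c f g; rewrite /eta_numerator swapP !tauP twistD; congr (_ + _).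
by rewrite /twist -!pres_scaleAr -scalerBr -scalerDr.
Qed.

HB.instance Definition _ i k := GRing.isLinear.Build K P P *:%R
  (eta_numerator i k) (eta_numerator_linear i k).

(** Twisted Leibniz rule: left multiplication by a letter changes the sign of the
numerator, up to a multiple of the denominator. *)
Lemma eta_numeratorMX i k j f : i != k ->
  eta_numerator i k (x j * f) =
    - (x j * eta_numerator i k f) +
    ((x i ^+ 2 - x k ^+ 2) * swap i k f) *+ ((j == i) || (j == k)).
Proof.
move=> ik; rewrite /eta_numerator swapM !tauM swapX !tauX.
have ki : x k * x i = - (x i * x k) by apply: skew_anticomm; rewrite eq_sym.
have [->|ji] := eqVneq j i.
  by rewrite tpermL (negPf ik) twistM_left.
have [->|jk] := eqVneq j k.
  by rewrite tpermR twistM_right.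
rewrite tpermD 1?eq_sym // addr0.
by apply: twistM_other; apply: skew_anticomm; rewrite eq_sym.
Qed.

Lemma eta_numerator_dvd i k f : i != k ->
  exists h, eta_numerator i k f = (x i ^+ 2 - x k ^+ 2) * h.
Proof.
move=> ik; elim/skew_ind: f => [|j f [h Eh]|c f g [h Eh] [h' Eh']].
- by exists 0; rewrite /eta_numerator !rmorph1 twist1 mulr0.
- exists (- (x j * h) + swap i k f *+ ((j == i) || (j == k))).
  rewrite eta_numeratorMX // Eh mulrDr mulrN mulrnAr !mulrA; congr (- (_ * _) + _).
  by rewrite mulrBr mulrBl !sqrX_central.
by exists (c *: h + h'); rewrite linearP /= Eh Eh' mulrDr pres_scaleAr.
Qed.

Lemma skewloc_mapM f g : iota (f * g) = iota f * iota g.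
Proof. exact: (rmorphM (@loc_map _ _ _ (@skew_rel K n) (@denom K n))). Qed.

Lemma skewloc_mapD f g : iota (f + g) = iota f + iota g.
Proof. exact: (raddfD (@loc_map _ _ _ (@skew_rel K n) (@denom K n))). Qed.

Lemma skewloc_map0 : iota 0 = 0.
Proof. exact: (raddf0 (@loc_map _ _ _ (@skew_rel K n) (@denom K n))). Qed.

Lemma skewloc_mapN f : iota (- f) = - iota f.
Proof. exact: (raddfN (@loc_map _ _ _ (@skew_rel K n) (@denom K n))). Qed.

Lemma skewloc_mapZ c f : iota (c *: f) = c *: iota f.
Proof. exact: (pres_subst_scalable (@loc_map_rel K _ _ (@skew_rel K n) (@denom K n)) c f). Qed.

Lemma iota_denom_inv (i k : 'I_n) : i != k ->
  exists2 z, z * iota (x i ^+ 2 - x k ^+ 2) = 1 & iota (x i ^+ 2 - x k ^+ 2) * z = 1.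
Proof.
move=> ik.
pose p : {p : 'I_n * 'I_n | p.1 != p.2} := exist _ (i, k) ik.
pose pi := pres_pi (@loc_rel K _ _ (@skew_rel K n) (@denom K n)).
have E : iota (x i ^+ 2 - x k ^+ 2) = pi (loc_lift _ (@denom K n (inr p))).
  have -> : x i ^+ 2 - x k ^+ 2 = pres_pi (@skew_rel K n) (@denom K n (inr p)).
    have sq j : x j ^+ 2 = pres_pi (@skew_rel K n) (fgen K j ^+ 2).
      by rewrite !expr2; exact: pres_rmulE.
    by rewrite !sq; exact: (esym (@pres_piB K _ (@skew_rel K n) _ _)).
  exact: (pres_subst_pi (@loc_map_rel K _ _ (@skew_rel K n) (@denom K n))).
exists (pi (fgen K (inr (inr p)))); rewrite E pres_rmulE -[1]/(pi 1).
  by apply/pres_piP => J _; apply; right; exists (inr p); right.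
by apply/pres_piP => J _; apply; right; exists (inr p); left.
Qed.

Lemma inv_denom_mul i k h : i != k ->
  inv_or0 (iota (x i ^+ 2 - x k ^+ 2)) * iota ((x i ^+ 2 - x k ^+ 2) * h) = iota h.
Proof.
case/iota_denom_inv => z zl zr.
by rewrite (inv_or0_eq zl zr) skewloc_mapM mulrA zl mul1r.
Qed.

Lemma inv_denomC i k : i != k ->
  inv_or0 (iota (x k ^+ 2 - x i ^+ 2)) = - inv_or0 (iota (x i ^+ 2 - x k ^+ 2)).
Proof.
have -> : iota (x k ^+ 2 - x i ^+ 2) = - iota (x i ^+ 2 - x k ^+ 2).
  by rewrite -(opprB (x i ^+ 2)) skewloc_mapN.
case/iota_denom_inv => z zl zr; rewrite (inv_or0_eq zl zr).
exact: inv_or0N zl zr.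
Qed.

Lemma swapK i k : involutive (swap i k : P -> P).
Proof.
elim/skew_ind => [|j f IHf|c f g IHf IHg]; first by rewrite !rmorph1.
  rewrite (swapM i k (x j) f) (@swapX K n i k j) (swapM i k _ (swap i k f)).
  by rewrite IHf swapX tpermK.
transitivity (swap i k (c *: swap i k f + swap i k g)).
  exact: (congr1 (swap i k) (swapP i k c f g)).
exact: etrans (swapP _ _ _ _ _) (congr2 (fun f' g' => c *: f' + g') IHf IHg).
Qed.

Lemma swap_homog i k d (f : P) : homog d f -> homog d (swap i k f).
Proof.
case=> F hF ->; exists (feval (fun j : 'I_n => fgen K (tperm i k j : 'I_n)) F).
  move=> v; rewrite -mcoeff_neq0; apply: contraNeq => vd.
  rewrite /feval mmapE raddf_sum /= big_seq big1 // => w wF.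
  rewrite mulr_algl mcoeffZ /word_eval.
  rewrite -(big_map (tperm i k : 'I_n -> 'I_n) xpredT (@fgen K 'I_n)) prod_fgen mcoeffU.
  case: eqP => [vE|_]; last by rewrite mulr0n mulr0.
  by case/eqP: vd; rewrite -vE -(hF w wF) /fdeg /= size_map.
exact: (pres_subst_pi (@swap_rel K n i k)).
Qed.

Lemma homog_hcomp d (f : P) : homog d (hcomp d f).
Proof.
exists (free_comp d (pres_repr f)) => // w.
by rewrite -mcoeff_neq0 free_compE; case: (fdeg w =P d) => // _; rewrite eqxx.
Qed.

Lemma hcomp_sum (f : P) :
  \sum_(d < mmeasure (@fdeg 'I_n) (pres_repr f)) hcomp d f = f.
Proof.
rewrite -[RHS]pres_reprK /hcomp -raddf_sum /=; congr pres_pi.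
apply/malgP => w; rewrite raddf_sum /=.
under eq_bigr => d _ do rewrite free_compE.
have [wF|wF] := boolP (w \in msupp (pres_repr f)); last first.
  by rewrite (mcoeff_outdom wF) big1 // => d _; rewrite mul0rn.
have wN : (fdeg w < mmeasure (@fdeg 'I_n) (pres_repr f))%N.
  apply: contraLR wF; rewrite -leqNgt => Nw.
  exact: (mmeasure_mnm_ge (mf := @fdeg 'I_n)).
rewrite (bigD1 (Ordinal wN)) //= eqxx big1 ?addr0 // => d.
by rewrite -val_eqE eq_sym => /negPf /= ->.
Qed.

(** The comparison of the two fractions on homogeneous elements. *)
Lemma odiff_loc_swap i k d f : i != k -> homog d f ->
  odiff_loc i k d (swap i k f) =
  inv_or0 (iota (x i ^+ 2 - x k ^+ 2)) * iota (eta_numerator i k f).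
Proof.
move=> ik hf.
have comm j : (-1) ^+ d * swap i k (swap i k f) * x j = x j * tau j f.
  exact: etrans (congr1 (fun g => _ * g * _) (swapK i k f)) (homogX_comm j hf).
have N := twist_odd_difference (swap i k f) (comm i) (comm k).
have := congr2 *%R (inv_denomC ik) (etrans (congr1 iota N) (skewloc_mapN _)).
by rewrite mulrNN.
Qed.

(** The right-hand side is additive in f, so the homogeneous case sums up to the
general one. *)
Lemma hext_odiff_swap i k f : i != k ->
  hext (odiff_loc i k) (swap i k f) =
  inv_or0 (iota (x i ^+ 2 - x k ^+ 2)) * iota (eta_numerator i k f).
Proof.
move=> ik; set c := inv_or0 _; rewrite /hext.
set g := fun d => hcomp d (swap i k f).
transitivity (c * \sum_(d < mmeasure (@fdeg 'I_n) (pres_repr (swap i k f)))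
    iota (eta_numerator i k (swap i k (g d)))).
  rewrite mulr_sumr; apply: eq_bigr => d _.
  apply: (etrans (congr1 (odiff_loc i k d) (esym (swapK i k (g d))))).
  by apply: odiff_loc_swap => //; apply: swap_homog; exact: homog_hcomp.
congr (c * _).
pose Phi (h : P) := iota (eta_numerator i k (swap i k h)).
have PhiD h h' : Phi (h + h') = Phi h + Phi h'.
  apply: etrans (skewloc_mapD _ _); congr (iota _).
  apply: etrans (raddfD (eta_numerator i k) _ _); congr (eta_numerator i k _).
  exact: (raddfD (swap i k)).
have Phi0 : Phi 0 = 0.
  by apply: (addrI (Phi 0)); rewrite -PhiD !addr0.
transitivity (Phi (\sum_(d < mmeasure (@fdeg 'I_n) (pres_repr (swap i k f))) g d)).
  by rewrite (big_morph Phi PhiD Phi0).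
rewrite /g hcomp_sum /Phi.
exact: (congr1 (fun h => iota (eta_numerator i k h)) (swapK i k f)).
Qed.

Lemma descendK (f : P) : descend (iota f) = f.
Proof.
rewrite /descend; case: xgetP => [g _ /skewloc_map_inj //|/(_ f)].
by case.
Qed.

End OddDividedDifferences.

(** Both sides are compared in the localization; there the equality holds term by
term, each term being the image of a skew polynomial. *)
Theorem eta_odiff (K : numFieldType) (n : nat) (t u : K) (i : 'I_n)
    (f : skewpoly K n) :
  eta t u i f =
    t *: delta i f + u *: \sum_(k < n | k != i) odiff i k (swap i k f).
Proof.
set S := \sum_(k < n | k != i) odiff i k (swap i k f).
rewrite -[RHS]descendK /eta; congr descend.
rewrite skewloc_mapD !skewloc_mapZ; congr (_ + _ *: _).
rewrite /S (big_morph _ (@skewloc_mapD K n) (skewloc_map0 K n)).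
apply: eq_bigr => k; rewrite eq_sym => ik.
have [h hE] := eta_numerator_dvd f ik.
have quotE : inv_or0 (skewloc_map (skewX i ^+ 2 - skewX k ^+ 2)) *
    skewloc_map (eta_numerator i k f) = skewloc_map h.
  by rewrite hE; exact: inv_denom_mul.
by rewrite /odiff (hext_odiff_swap f ik) quotE descendK.
Qed.

Theorem mainTheorem1 (R : realType) (n : nat) (t u : R[i]) (i : 'I_n)
    (hn : (2 <= n)%N) (ht : t != 0) (hu : u != 0) (f : skewpoly R[i] n) :
  eta t u i f =
    t *: delta i f + u *: \sum_(k < n | k != i) odiff i k (swap i k f).
Proof. exact: eta_odiff. Qed.
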